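(* For all integers $\ell \ge 2$ and $t \ge 2$, $$R_{t-1}^t(P_\ell)=\ell+\left\lfloor\frac{\ell-2}{2^t-2}\right\rfloor.$$
   Context: $P_\ell$ denotes the path with $\ell$ vertices. For a graph $H$ and integers $t\ge k\ge 1$, $R^t_k(H)$ is the minimum integer $N$ such that in every colouring of the edges of the complete graph $K_N$ with $t$ colours there is a copy of $H$ whose edges use at most $k$ different colours. In particular, $R^t_{t-1}(P_\ell)$ is the least $N$ such that every $t$-edge-colouring of $K_N$ contains a copy of $P_\ell$ whose edges use at most $t-1$ colours. *)

(* Defs.v *)
From HB Require Import structures.
From mathcomp Require Import all_boot.

Set Implicit Arguments.
Unset Strict Implicit.
Unset Printing Implicit Defensive.

Record sgraph := SGraph {
  vertex :> finType;
  adj : rel vertex;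
  adj_sym : symmetric adj;
  adj_irrefl : irreflexive adj
}.

Definition edges (H : sgraph) : {set {set H}} :=
  [set [set p.1; p.2] | p : H * H & adj p.1 p.2].

Definition path_adj (l : nat) : rel 'I_l :=
  fun i j => (i.+1 == j :> nat) || (j.+1 == i :> nat).

Lemma path_adj_sym l : symmetric (@path_adj l).
Proof. by move=> i j; rewrite /path_adj orbC. Qed.

Lemma path_adj_irrefl l : irreflexive (@path_adj l).
Proof. by move=> i; rewrite /path_adj orbb gtn_eqF. Qed.

(* The path with l vertices, hence with l - 1 edges. *)
Definition path_graph (l : nat) : sgraph :=
  SGraph (@path_adj_sym l) (@path_adj_irrefl l).

(* The edges of K_N are the 2-element subsets of 'I_N; the values of a
   colouring on subsets of any other size are never used.  Not every colour
   has to occur. *)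
Definition edge_colouring (N t : nat) := {ffun {set 'I_N} -> 'I_t}.

(* Every injection f of the vertices of H into 'I_N is a copy of H in K_N,
   with edges the f @: e for e an edge of H. *)
Definition copy_colours (N t : nat) (c : edge_colouring N t) (H : sgraph)
    (f : H -> 'I_N) : {set 'I_t} :=
  [set c (f @: e) | e : {set H} in edges H].

Definition ramsey_arrow (t k : nat) (H : sgraph) (N : nat) : Prop :=
  forall c : edge_colouring N t,
    exists2 f : H -> 'I_N, injective f & #|copy_colours c f| <= k.

(* R^t_k(H) = N, as a relation: N is the minimum of the N' such that
   ramsey_arrow t k H N' holds (in particular such N' exist). *)
Definition chromatic_ramsey_number (t k : nat) (H : sgraph) (N : nat) : Prop :=
  ramsey_arrow t k H N /\ (forall M, ramsey_arrow t k H M -> N <= M).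

(* Main.v *)
Require Import Defs.
From mathcomp Require Import all_boot.
From mathcomp Require Import zify.
From Stdlib Require Import Classical_Prop.

(* Upper bound. Let H_i be the graph of the edges not coloured i, and suppose
   that no H_i has a path on N - m + 1 vertices, with m >= 1. A closure and
   degree argument in the style of Bondy-Chvatal and Posa gives for each i a
   set A_i of k_i vertices, each of degree at most N/2 - 1 in H_i and with at
   most k_i - m neighbours in H_i outside A_i. Every edge lies in H_i or in H_j
   when i <> j, so the degree bound makes the A_i disjoint, and counting the
   edges between them gives, for each set J of colours,
     sum_(i in J) k_i (k_i - m) >= sum_(i < j in J) k_i k_j.
   Hence k_1 <= ... <= k_t implies k_i >= 2^(i-1) m, and N >= (2^t - 1) m; the
   last case of equality is excluded by a sharper bound on the largest A_i.

   Lower bound. Take classes of sizes q, 2 q, 4 q, ..., the last one being what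
   remains, and colour an edge with the index of the lowest class that it
   meets. A path without colour i can visit class i only between vertices of
   the lower classes. *)

Set Implicit Arguments.
Unset Strict Implicit.
Unset Printing Implicit Defensive.

(** * Long paths: rotation, closure and sparse sets of low degree *)

Section Paths.

Variable T : finType.
Implicit Types (e : rel T) (S : {set T}) (p : seq T).

Definition has_path e S n :=
  exists p, [/\ uniq p, sorted e p, {subset p <= S} & n <= size p].

Definition deg e S x := #|[set y in S :\ x | e x y]|.

Lemma sorted_cat e x0 s1 s2 :
  sorted e (s1 ++ s2) =
  [&& sorted e s1, sorted e s2
    & nilp s1 || nilp s2 || e (last x0 s1) (head x0 s2)].
Proof.
case: s1 s2 => [|a s1] [|b s2] //=; rewrite ?cats0 ?andbT //.
by rewrite cat_path /= [e _ _ && _]andbC.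
Qed.

Lemma last_rev (x : T) s : last x (rev s) = head x s.
Proof. by case: s => //= y s; rewrite rev_cons last_rcons. Qed.

Lemma head_rev (x : T) s : head x (rev s) = last x s.
Proof. by rewrite -last_rev revK. Qed.

Lemma sorted_rev e s : symmetric e -> sorted e (rev s) = sorted e s.
Proof. by move=> esym; rewrite rev_sorted; apply: eq_sorted => u v. Qed.

(** Each of the [size z] consecutive pairs of [h :: z] counts at most once: through its first entry
    by [P] or through its second by [R]. *)
Lemma count_consecutive (P R : pred T) h z :
    (forall z1 u v z2, h :: z = z1 ++ u :: v :: z2 -> ~~ (P u && R v)) ->
  count P (belast h z) + count R z <= size z.
Proof.
elim: z h => [|v z IH] h Hz //=.
have := IH v (fun z1 u w z2 E => Hz (h :: z1) u w z2 (congr1 (cons h) E)).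
by have := Hz [::] h v z erefl; case: (P h); case: (R v) => //= _; lia.
Qed.

(* If v follows u on x :: a and y were adjacent to u and x to v, then going
   from the end of a back to v, then from x to u, then along y :: b would be a
   path on the same vertices. *)
Lemma rotation_count e S x y a b :
    symmetric e -> path e x a -> path e y b ->
    uniq (x :: a ++ y :: b) -> {subset x :: a ++ y :: b <= S} ->
    ~ has_path e S (size (x :: a ++ y :: b)) ->
  count (e x) a + count (e y) (x :: a) <= size a.
Proof.
move=> esym pa pb Uab Sab noP.
have Prev c : perm_eq c (x :: a ++ y :: b) -> ~~ sorted e c.
  move=> Ec; apply/negP => sc; apply: noP; exists c; split => //.
  - by rewrite (perm_uniq Ec).
  - by move=> z; rewrite (perm_mem Ec); apply: Sab.
  - by rewrite (perm_size Ec).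
have revs s := sorted_rev s esym.
(* The last vertex of [x :: a] is split off; it is not adjacent to [y], since otherwise the two
   paths could be joined there. *)
rewrite lastI -cats1 count_cat /= addn0.
have /negbTE -> : ~~ e y (last x a).
  have /Prev : perm_eq (rev (y :: b) ++ rev (x :: a)) (x :: a ++ y :: b).
    by rewrite -rev_cat perm_rev.
  by rewrite (sorted_cat _ x) !revs /= pa pb last_rev head_rev /= negb_or => /andP[].
rewrite addn0 addnC; apply: count_consecutive => z1 u v z2 E.
apply/negP => /andP[yu xv].
have /Prev/negP : perm_eq (rev (v :: z2) ++ rcons z1 u ++ y :: b)
    (x :: a ++ y :: b).
  rewrite -cat_cons E catA perm_cat2r -(cat1s u) catA cats1.
  by rewrite perm_catC perm_cat2l perm_rev.
apply.
have hE : x = head x (rcons z1 u) by case: (z1) E => [|? ?] [->].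
have : sorted e (x :: a) by [].
rewrite E -(cat1s u) catA cats1 (sorted_cat _ x) => /and3P[s1 s2 _].
rewrite (sorted_cat _ x) revs s2 (sorted_cat _ x) s1 /= pb last_rcons esym yu.
rewrite last_rev orbT /=; apply/orP; right.
by rewrite esym; case: (z1) hE => [|? ?] /= <-.
Qed.

Lemma deg_split e S x s : uniq (x :: s) -> {subset x :: s <= S} ->
  deg e S x = count (e x) s + #|[set z in S :\: [set z in x :: s] | e x z]|.
Proof.
move=> /= /andP[xs Us] sS.
rewrite /deg -(cardsID [set z in x :: s]); congr (_ + _).
  rewrite -size_filter -(card_uniqP _) ?filter_uniq //.
  apply: eq_card => z; rewrite !inE mem_filter.
  case: (eqVneq z x) => [->|_] /=; first by rewrite (negbTE xs) andbF.
  case: (boolP (z \in s)) => zs; rewrite ?andbF //= andbT.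
  by rewrite andbT sS // in_cons zs orbT.
by apply: eq_card => z; rewrite !inE; case: (eqVneq z x); rewrite //= andbA.
Qed.

Definition add_edge e x y : rel T :=
  fun u v => [|| e u v, (u == x) && (v == y) | (u == y) && (v == x)].

(** The two paths are joined only by the missing edge [xy]. If there is no long path,
    [rotation_count], used from both ends, bounds the degrees of [x] and [y] inside the paths by
    [size a + size b] in total. Outside, they have no common neighbour [d], as [x d y] could replace
    the edge. So the degree sum is at most [#|S| - 2]. *)
Lemma path_through e S x y a b n :
    symmetric e -> x != y -> ~~ e x y -> #|S| <= (deg e S x + deg e S y).+1 ->
    path e x a -> path e y b ->
    uniq (x :: a ++ y :: b) -> {subset x :: a ++ y :: b <= S} ->
    n <= size (x :: a ++ y :: b) ->
  has_path e S n.
Proof.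
move=> esym xy nxy dS pa pb U sS sz; apply: NNPP => noP.
have noQ k : n <= k -> ~ has_path e S k.
  move=> nc [p [Up ep pS cp]]; apply: noP; exists p; split=> //.
  exact: leq_trans cp.
have pe : perm_eq (y :: b ++ x :: a) (x :: a ++ y :: b).
  by rewrite -!cat_cons perm_catC.
have U' : uniq (y :: b ++ x :: a) by rewrite (perm_uniq pe).
have sS' : {subset y :: b ++ x :: a <= S}.
  by move=> z; rewrite (perm_mem pe); apply: sS.
have sz' : n <= size (y :: b ++ x :: a) by rewrite (perm_size pe).
have h1 := rotation_count esym pa pb U sS (noQ _ sz).
have h2 := rotation_count esym pb pa U' sS' (noQ _ sz').
move: dS; rewrite (deg_split e U sS) (deg_split e U' sS') !count_cat.
set Q := [set z in x :: a ++ y :: b].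
have -> : [set z in y :: b ++ x :: a] = Q.
  by apply/setP => z; rewrite !inE -!in_cons (perm_mem pe).
have cQ : #|Q| = size (x :: a ++ y :: b).
  by rewrite cardsE; apply/card_uniqP.
have QS : Q \subset S by apply/subsetP => z; rewrite inE; apply: sS.
have : #|[set z in S :\: Q | e x z]| + #|[set z in S :\: Q | e y z]|
    <= #|S| - #|Q|.
  rewrite -cardsDS // -cardsUI.
  set I := _ :&: _.
  have -> : I = set0.
    apply/eqP; rewrite -subset0; apply/subsetP => d; rewrite !inE.
    move=> /andP[/andP[/andP[dQ dS] xd] /andP[_ yd]]; case: noP.
    exists (rev (x :: a) ++ d :: y :: b).
    have pd : perm_eq (rev (x :: a) ++ d :: y :: b) (d :: x :: a ++ y :: b).
      by rewrite -(cat1s d) perm_catCA /= perm_cons -cat_cons perm_cat2r perm_rev.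
    split.
    - by rewrite (perm_uniq pd) cons_uniq U inE dQ.
    - rewrite (sorted_cat _ x) sorted_rev //= pa pb last_rev /= xd.
      by rewrite esym yd orbT.
    - move=> z; rewrite (perm_mem pd) inE => /orP[/eqP->//|]; exact: sS.
    - by rewrite (perm_size pd) (leq_trans sz).
  rewrite cards0 addn0; apply: subset_leq_card; apply/subsetP => z.
  by rewrite !inE => /orP[]/andP[].
have := subset_leq_card QS; move: h1 h2 => /=; rewrite cQ /= size_cat /=.
lia.
Qed.

Lemma add_edge_path e S x y n :
    symmetric e -> x != y -> ~~ e x y -> #|S| <= (deg e S x + deg e S y).+1 ->
  has_path (add_edge e x y) S n -> has_path e S n.
Proof.
move=> esym xy nxy dS [p [Up sp pS np]].
case: (boolP (sorted e p)) => [se|nse]; first by exists p.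
have revs s := sorted_rev s esym.
have [p1 [u [v [p2 [Ep nuv]]]]] :
    exists p1 u v p2, p = p1 ++ u :: v :: p2 /\ ~~ e u v.
  elim: (p) nse => // h q IH /=; case: q IH => // h' q IH /=.
  rewrite negb_and => /orP[nh|/IH]; first by exists [::], h, h', q.
  by move=> [p1 [u [v [p2 [-> nuv]]]]]; exists (h :: p1), u, v, p2.
(* A segment that misses [x] or [y] cannot use the new edge; cutting the path at that edge leaves
   two such segments. *)
have sub s z : z \in [:: x; y] -> z \notin s ->
    sorted (add_edge e x y) s -> sorted e s.
  move=> zxy zs; apply: (@sub_in_sorted _ (fun w => w != z)); last first.
    by apply/allP => w ws; apply: contraNneq zs => <-.
  move=> w1 w2; rewrite /add_edge.
  move: zxy; rewrite !inE => /orP[]/eqP-> /negbTE n1 /negbTE n2;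
  by rewrite n1 n2 ?andbF !orbF.
have uvxy : (u = x /\ v = y) \/ (u = y /\ v = x).
  move: sp; rewrite Ep (sorted_cat _ x) => /and3P[_ /= /andP[+ _] _].
  rewrite /add_edge (negbTE nuv) /=.
  by case/orP => /andP[/eqP-> /eqP->]; [left|right].
have uin : (u \in [:: x; y]) && (v \in [:: x; y]).
  by rewrite !inE; case: uvxy => -[-> ->]; rewrite !eqxx ?orbT.
have Ep' : p = rcons p1 u ++ v :: p2 by rewrite cat_rcons.
have su : sorted e (rcons p1 u).
  apply: (sub _ v); first by case/andP: uin.
    move: Up; rewrite Ep' cat_uniq /= negb_or => /and3P[_ /andP[+ _] _].
    by [].
  by move: sp; rewrite Ep' (sorted_cat _ x) => /and3P[].
have sv : sorted e (v :: p2).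
  apply: (sub _ u); first by case/andP: uin.
    move: Up; rewrite Ep cat_uniq => /and3P[_ _ /=].
    by case/andP.
  by move: sp; rewrite Ep' (sorted_cat _ x) => /and3P[].
have pe : perm_eq (u :: rev p1 ++ v :: p2) p.
  by rewrite Ep' -cat_cons -rev_rcons perm_cat2r perm_rev.
have pu : path e u (rev p1) by rewrite -revs rev_rcons in su.
have U : uniq (u :: rev p1 ++ v :: p2) by rewrite (perm_uniq pe).
have sS : {subset u :: rev p1 ++ v :: p2 <= S}.
  by move=> z; rewrite (perm_mem pe); apply: pS.
have sz : n <= size (u :: rev p1 ++ v :: p2) by rewrite (perm_size pe).
case: uvxy => -[Eu Ev]; subst u v.
  exact: (path_through esym xy nxy dS pu sv U sS sz).
apply: (path_through esym _ _ _ pu sv U sS sz); rewrite 1?eq_sym 1?esym //.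
by rewrite addnC.
Qed.
Lemma has_path_sub e S S' n : S \subset S' -> has_path e S n -> has_path e S' n.
Proof.
move=> /subsetP SS [p [Up ep pS np]].
by exists p; split=> // z /pS /SS.
Qed.

Lemma deg_subrel e e' S x : subrel e e' -> deg e S x <= deg e' S x.
Proof.
move=> ee; apply: subset_leq_card; apply/subsetP => z; rewrite !inE.
by move=> /andP[-> /ee].
Qed.

Lemma deg_subset e S S' x : S \subset S' -> deg e S x <= deg e S' x.
Proof.
move=> SS; apply: subset_leq_card; apply/subsetP => z; rewrite !inE.
by move=> /andP[/andP[-> /(subsetP SS) ->] ->].
Qed.

Lemma add_edge_sym e x y : symmetric e -> symmetric (add_edge e x y).
Proof.
by move=> esym u v; rewrite /add_edge esym; congr (_ || _);
   rewrite orbC [X in X || _]andbC [X in _ || X]andbC.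
Qed.

(** The missing edges are added one at a time; degrees only grow, so the degree condition persists,
    and [add_edge_path] undoes each addition. *)
Lemma closure_path e e' S n : symmetric e -> symmetric e' -> subrel e e' ->
    (forall x y, x \in S -> y \in S -> x != y -> e' x y -> ~~ e x y ->
      #|S| <= (deg e S x + deg e S y).+1) ->
  has_path e' S n -> has_path e S n.
Proof.
have [k] := ubnP #|[set p : T * T | [&& p.1 \in S, p.2 \in S, p.1 != p.2,
  e' p.1 p.2 & ~~ e p.1 p.2]]|.
elim: k e => // k IH e lek esym esym' ee' hS hp.
case: (pickP [pred p : T * T | [&& p.1 \in S, p.2 \in S, p.1 != p.2,
  e' p.1 p.2 & ~~ e p.1 p.2]]) => [[x y] /= /and5P[xS yS xy exy nxy]|no].
  apply: (add_edge_path esym xy nxy (hS _ _ xS yS xy exy nxy)).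
  have se : subrel e (add_edge e x y) by move=> u v; rewrite /add_edge => ->.
  apply: IH => //; last 1 first.
  - move=> u v uS vS uv euv; rewrite negb_or => /andP[nuv _].
    apply: leq_trans (hS _ _ uS vS uv euv nuv) _.
    by rewrite ltnS leq_add ?deg_subrel.
  - rewrite -ltnS; apply: leq_trans lek; rewrite ltnS.
    apply: proper_card; apply/properP; split.
      apply/subsetP => -[u v]; rewrite !inE /= => /and5P[-> -> -> ->].
      by rewrite negb_or => /andP[].
    exists (x, y); rewrite !inE /= ?xS ?yS ?xy ?exy ?nxy //.
    by rewrite /add_edge !eqxx /= !orbT.
  - exact: add_edge_sym.
  - move=> u v; rewrite /add_edge => /or3P[/ee'//||] /andP[/eqP-> /eqP->] //.
    by rewrite esym'.
have [p [Up sp pS np]] := hp; exists p; split=> //.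
elim: p Up sp pS {np} => // u [|v p] IHp //= Up /andP[uv vp] pS.
rewrite -[path e v p]/(sorted e (v :: p)) IHp //; last by move=> z zp; apply: pS; rewrite inE zp orbT.
  rewrite andbT; move: (no (u, v)) => /=.
  rewrite !pS ?uv ?inE ?eqxx ?orbT //=.
  move: Up; rewrite inE negb_or => /andP[/andP[-> _] _] /=.
  by move/negbFE.
by case/andP: Up.
Qed.

Definition clique e S := {in S &, forall x y, x != y -> e x y}.

Lemma clique_path e S : clique e S -> has_path e S #|S|.
Proof.
move=> cS; exists (enum S); split; rewrite ?enum_uniq ?cardE //; last first.
  by move=> z; rewrite mem_enum.
have : {subset enum S <= S} by move=> z; rewrite mem_enum.
elim: (enum S) (enum_uniq S) => // u [|v p] IHp //= Up pS.
rewrite -[path e v p]/(sorted e (v :: p)) IHp; first last.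
- by move=> z zp; apply: pS; rewrite inE zp orbT.
- by case/andP: Up.
rewrite andbT cS ?pS ?inE ?eqxx ?orbT //.
by move: Up; rewrite inE negb_or => /andP[/andP[]].
Qed.

(* Removing from A, one after the other, vertices with many neighbours outside
   A leaves D; adding the removed vertices in the reverse order, each can be
   joined to all the vertices of the clique built so far. *)
Lemma greedy_path e m k (A : {set T}) : symmetric e -> #|A| = k + m ->
    (forall B : {set T}, B \subset A -> m < #|B| ->
      exists2 x, x \in B & #|B| <= deg e (~: B) x + m) ->
  exists D : {set T}, [/\ D \subset A, #|D| = m &
    forall e', symmetric e' -> subrel e e' -> clique e' (~: A) ->
      has_path e' (~: D) #|~: D|].
Proof.
move=> esym; elim: k A => [|k IH] A cA hA.
  by exists A; split=> // e' _ _; exact: clique_path.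
have [x xA hx] := hA A (subxx _) ltac:(lia).
have cAx : #|A :\ x| = k + m by have := cardsD1 x A; rewrite xA; lia.
have [|D [DA cD hD]] := IH (A :\ x) cAx.
  by move=> B BA; apply: hA; apply: subset_trans BA (subsetDl _ _).
exists D; split=> //; first exact: subset_trans DA (subsetDl _ _).
move=> e' esym' ee' cl.
(* [f] makes the complement of [A :\ x] a clique, as the induction needs. Its new edges satisfy the
   closure condition in [~: D]: [x] has degree above [k], its new neighbours at least [#|~: A| - 1],
   and [#|~: D| = #|~: A| + k.+1]. *)
pose f u v := [|| e' u v, (u == x) && (v \notin A) | (v == x) && (u \notin A)].
have fsym : symmetric f.
  by move=> u v; rewrite /f esym'; congr (_ || _); rewrite orbC.
have ef : subrel e' f by move=> u v; rewrite /f => ->.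
have xD : x \notin D by apply/negP => /(subsetP DA); rewrite !inE eqxx.
have AD : ~: A \subset ~: D.
  by rewrite setCS (subset_trans DA) ?subsetDl.
have dx : k < deg e' (~: D) x.
  apply: leq_trans (deg_subset _ _ AD); apply: leq_trans (deg_subrel _ _ ee').
  lia.
have db y : y \notin A -> #|~: A| <= (deg e' (~: D) y).+1.
  move=> yA; rewrite (cardsD1 y) inE yA ltnS.
  apply: subset_leq_card; apply/subsetP => z; rewrite !inE => /andP[zy zA].
  have zD : z \notin D by have := subsetP AD z; rewrite !inE; apply.
  by rewrite zy zD cl ?inE // eq_sym.
apply: (closure_path esym' fsym ef).
  move=> u v uD vD uv fuv nuv.
  have [cAC cDC] := (cardsC A, cardsC D).
  have [/andP[/eqP Eu vA]|/andP[/eqP Ev uA]] :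
      (u == x) && (v \notin A) \/ (v == x) && (u \notin A).
    by move: fuv; rewrite /f (negbTE nuv) /= => /orP.
  - by have := db v vA; rewrite Eu; lia.
  - by have := db u uA; rewrite Ev; lia.
apply: hD => //; first by move=> u v /ee' /ef.
move=> u v; rewrite !inE !negb_and !negbK /f => /orP[/eqP->|uA] /orP[/eqP->|vA] uv.
- by rewrite eqxx in uv.
- by rewrite eqxx vA orbT.
- by rewrite eqxx uA !orbT.
- by rewrite cl ?inE.
Qed.

Definition low e := [set x : T | 2 * deg e setT x + 2 <= #|T|].

(** If there were no such [B], [greedy_path] would give a path missing only [m] vertices; when
    [#|A| < m], the clique [~: A] already contains one. *)
Lemma sparse_subset e e' m (A : {set T}) : symmetric e -> symmetric e' ->
    subrel e e' -> clique e' (~: A) -> ~ has_path e' setT (#|T| - m) ->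
  exists B : {set T}, [/\ B \subset A, 0 < #|B| &
    {in B, forall x, deg e (~: B) x + m < #|B|}].
Proof.
move=> esym esym' ee' cl noP.
case: (pickP [pred B : {set T} | [&& B \subset A, 0 < #|B| &
    [forall (x | x \in B), deg e (~: B) x + m < #|B|]]]) => [B /and3P[BA B0]|no].
  by move=> /forall_inP hB; exists B.
have cAC := cardsC A.
case: (leqP m #|A|) => [mA|Am]; last first.
  have [p [Up sp _ np]] := clique_path cl.
  case: noP; exists p; split=> //; first by move=> z; rewrite inE.
  by apply: leq_trans np; lia.
have [||D [DA cD hD]] := @greedy_path e m (#|A| - m) A esym; first by lia.
  move=> B BA mB; have := no B; rewrite /= BA (leq_ltn_trans _ mB) //=.
  move=> /negbT; rewrite negb_forall => /existsP[x].
  by rewrite negb_imply -leqNgt => /andP[]; exists x.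
case: noP; apply: has_path_sub (subsetT (~: D)) _.
have <- : #|~: D| = #|T| - m by have := cardsC D; lia.
exact: hD.
Qed.

(* The vertices outside [low e] have pairwise degree sum at least #|T| - 1, so
   they may be assumed to form a clique. *)
Lemma low_sparse_subset e m : symmetric e -> ~ has_path e setT (#|T| - m) ->
  exists B : {set T}, [/\ B \subset low e, 0 < #|B|,
    {in B, forall x, deg e (~: B) x + m < #|B|} &
    2 * #|B| = #|T| + m.+1 -> {in B, forall x, (deg e (~: B) x + m).+1 < #|B|}].
Proof.
move=> esym noP.
set L := low e.
pose e' u v := e u v || (u \notin L) && (v \notin L).
have esym' : symmetric e' by move=> u v; rewrite /e' esym andbC.
have ee' : subrel e e' by move=> u v; rewrite /e' => ->.
have noP' : ~ has_path e' setT (#|T| - m).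
  move=> hp; apply: noP; apply: (closure_path esym esym' ee' _ hp).
  move=> x y _ _ xy; rewrite /e' => + /negbTE nxy; rewrite nxy /= !inE cardsT.
  by lia.
clearbody L.
have clL : clique e' (~: L).
  by move=> u v; rewrite !inE /e' => uL vL _; rewrite uL vL orbT.
have small (A : {set T}) : A \subset L -> clique e' (~: A) -> 2 * #|A| < #|T| + m.+1 ->
    exists B : {set T}, [/\ B \subset L, 0 < #|B|,
    {in B, forall x, deg e (~: B) x + m < #|B|} &
    2 * #|B| = #|T| + m.+1 -> {in B, forall x, (deg e (~: B) x + m).+1 < #|B|}].
  move=> AL clA cA; have [B [BA B0 hB]] := sparse_subset esym esym' ee' clA noP'.
  exists B; split=> //; first exact: subset_trans BA AL.
  by have := subset_leq_card BA; lia.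
have cLC := cardsC L.
have degL x (A : {set T}) : deg e A x <= #|A :\ x|.
  by apply: subset_leq_card; apply/subsetP => z; rewrite inE => /andP[].
case: (ltnP (2 * #|L|) (#|T| + m.+1)) => [|bigL]; first exact: small.
case: (boolP [forall (x | x \in L), (deg e (~: L) x + m).+1 < #|L|]).
  move=> /forall_inP hL; exists L; split=> //; first by lia.
  by move=> x xL; have := hL x xL; lia.
(* Failure of the sharper bound at [x] forces [2 * #|L| = #|T| + m.+1] and makes [x] adjacent to
   everything outside [L]. So [x] can join the clique, and [L :\ x] is small. *)
rewrite negb_forall => /existsP[x]; rewrite negb_imply => /andP[xL dx].
have dx' := degL x (~: L); have := cardsD1 x (~: L); rewrite inE xL /= => cx.
have := cardsD1 x L; rewrite xL => cLx.
apply: (small (L :\ x)); [exact: subsetDl| |lia].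
have adjx v : v \notin L -> e x v.
  move=> vL; have : [set y in ~: L :\ x | e x y] = ~: L :\ x.
    apply/eqP; rewrite eqEcard; apply/andP; split.
      by apply/subsetP => z; rewrite inE => /andP[].
    by move: dx dx' cx; rewrite /deg; lia.
  have vx : v != x by apply: contraNneq vL => ->.
  by move/setP/(_ v); rewrite !inE vL vx /=.
move=> u v; rewrite !inE !negb_and !negbK /e'.
move=> /orP[/eqP->|uL] /orP[/eqP->|vL] uv; first by rewrite eqxx in uv.
- by rewrite adjx // inE.
- by rewrite esym adjx // inE.
- by rewrite uL vL orbT.
Qed.

End Paths.

(** * Counting edges between disjoint sets *)

Section Counting.

Variables (I T : finType) (h : I -> rel T) (A : I -> {set T}).
Hypothesis h_cover : forall i j x y, i != j -> x != y -> h i x y || h j x y.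
Hypothesis h_sym : forall i, symmetric (h i).
Hypothesis disjA : forall i j, i != j -> [disjoint A i & A j].

Lemma sum_card_disjoint (J : {set I}) : \sum_(i in J) #|A i| <= #|T|.
Proof.
have := partition_disjoint_bigcup addn (fun _ : T => 1) disjA.
rewrite sum1_card => E.
apply: leq_trans (max_card (mem (\bigcup_i A i))).
rewrite E (bigID (mem J)) /=; apply: leq_trans (leq_addr _ _).
by apply: leq_sum => i _; rewrite sum1_card.
Qed.

Lemma sum_deg_disjoint (J : {set I}) i x : x \in A i ->
  \sum_(j in J | j != i) \sum_(y in A j) h i x y <= deg (h i) (~: A i) x.
Proof.
move=> xA; rewrite /deg -sum1_card.
pose F y := if y \notin A i then h i x y : nat else 0.
have := partition_disjoint_bigcup addn F disjA.
move=> E; apply: (@leq_trans (\sum_(y in \bigcup_i A i) F y)).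
  rewrite E big_mkcond /=; apply: leq_sum => j _; case: ifP => // /andP[_ ji].
  apply: leq_sum => y yA; rewrite /F ifT //.
  by apply/negP => yAi; have /pred0P/(_ y) := disjA ji; rewrite /= yA yAi.
rewrite big_mkcond [X in _ <= X]big_mkcond /=; apply: leq_sum => y _.
case: ifP => // _; rewrite /F !inE; case: ifP => // yA.
have -> : y != x by apply: contraNneq yA => ->.
by case: (h i x y).
Qed.

Lemma card_mul_le i j : i != j ->
  #|A i| * #|A j| <= \sum_(x in A i) \sum_(y in A j) h i x y
                   + \sum_(x in A j) \sum_(y in A i) h j x y.
Proof.
move=> ij; rewrite [X in _ + X]exchange_big /= -big_split /=.
rewrite -sum_nat_const; apply: leq_sum => x xA.
rewrite -big_split /= -sum1_card; apply: leq_sum => y yA.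
have xy : x != y.
  by apply: contraTneq yA => <-; rewrite (disjointFr (disjA ij)).
by rewrite (h_sym j y x); have := h_cover ij xy; do 2 case: (h _ _ _).
Qed.

(** The square is expanded: each cross term [#|A i| * #|A j|] is at most [E i j + E j i] because
    every pair is covered, and the [E i j] for fixed [i] sum to at most [#|A i| * b i]. *)
Lemma sum_card_sqr (b : I -> nat) (J : {set I}) :
    (forall i, {in A i, forall x, deg (h i) (~: A i) x <= b i}) ->
  (\sum_(i in J) #|A i|) ^ 2 <=
  \sum_(i in J) #|A i| ^ 2 + 2 * \sum_(i in J) #|A i| * b i.
Proof.
move=> hb.
pose E i j := \sum_(x in A i) \sum_(y in A j) h i x y.
have hE i : \sum_(j in J | j != i) E i j <= #|A i| * b i.
  rewrite exchange_big /= -sum_nat_const; apply: leq_sum => x xA.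
  exact: leq_trans (sum_deg_disjoint J xA) (hb i x xA).
rewrite -mulnn big_distrlr /=.
apply: (@leq_trans (\sum_(i in J) (#|A i| ^ 2 +
   \sum_(j in J | j != i) (E i j + E j i)))).
  apply: leq_sum => i iJ; rewrite (bigD1 i iJ) /= mulnn leq_add2l.
  by apply: leq_sum => j /andP[_ ji]; apply: card_mul_le; rewrite eq_sym.
rewrite big_split leq_add2l /= mul2n -addnn.
under eq_bigr => i _ do rewrite big_split /=.
rewrite big_split /=; apply: leq_add; first exact: leq_sum.
rewrite (exchange_big_dep (mem J)) /=; last by move=> i j _ /andP[].
apply: leq_sum => i iJ; apply: leq_trans (hE i); apply: eq_leq.
by apply: eq_bigl => j; rewrite iJ /= eq_sym.
Qed.

End Counting.

(** * Exponential growth of the set sizes *)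

(** Adding the hypotheses cancels [S] and [Q]. Here [k] is a largest size, [S] and [Q] are the sums
    of the other sizes and of their squares, and [d] is a surplus used to exclude equality. *)
Lemma peel_max k S Q m a d :
    3 * Q + 2 * k * a <= S ^ 2 + 2 * m * S + 2 * k * S ->
    (k + S) ^ 2 + 2 * m * (k + S) + 2 * d <= 3 * (k ^ 2 + Q) ->
  k * (a + m) + d <= k * k.
Proof. by rewrite -!mulnn; nia. Qed.

Section Growth.

Variables (I : finType) (k : I -> nat) (m : nat).
Hypothesis k_gt0 : forall i, 0 < k i.
Hypothesis k_sqr : forall J : {set I},
  (\sum_(i in J) k i) ^ 2 + 2 * m * \sum_(i in J) k i
    <= 3 * \sum_(i in J) k i ^ 2.

(* [3 * Q - S ^ 2 - 2 * m * S] is twice the slack of the inequality on the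
   pairwise products. The second part bounds it from above by what adding one
   more largest element [x] can compensate, which forces
   [x >= 2 ^ #|J| * m] by [peel_max]. *)
Lemma growth (J : {set I}) (S := \sum_(i in J) k i) (Q := \sum_(i in J) k i ^ 2) :
  (2 ^ #|J| - 1) * m <= S /\
  forall x, {in J, forall i, k i <= x} ->
    3 * Q + 2 * x * ((2 ^ #|J| - 1) * m) <= S ^ 2 + 2 * m * S + 2 * x * S.
Proof.
rewrite {}/S {}/Q; have [n] := ubnP #|J|; elim: n J => // n IH J cJ.
have [->|[i0 i0J]] := set_0Vmem J.
  by rewrite !big_set0 cards0 expn0 subnn; split=> // x _; rewrite !muln0.
case: (arg_maxnP k i0J) => j /= jJ jmax.
have {}jJ : j \in J by [].
have [|HS HQ] := IH (J :\ j); first by move: cJ; rewrite (cardsD1 j) jJ; lia.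
have HQj := HQ (k j) (fun i iJ => jmax i (subsetP (subsetDl _ _) i iJ)).
have := k_sqr J; rewrite (cardsD1 j J) jJ !(big_setD1 j jJ) /= add1n (expnS 2).
have := k_gt0 j; have p2 : 0 < 2 ^ #|J :\ j| by rewrite expn_gt0.
case: (2 ^ _) p2 HS HQ HQj => // p _; rewrite subn1 /=.
move: (\sum_(i in _) k i) (\sum_(i in _) k i ^ 2) => S Q HS HQ HQj kj0 hJ.
have kp : p.+1 * m <= k j.
  rewrite -(leq_pmul2l kj0) mulSn addnC -[X in X <= _]addn0.
  by apply: (peel_max HQj); rewrite addn0.
split; first by nia.
move=> x hx; have jx := hx j jJ.
have HQx := HQ x (fun i iJ => hx i (subsetP (subsetDl _ _) i iJ)).
(* After subtracting [HQx] and using [S >= p * m], what remains is [h2], which holds because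
   [k j <= x]. *)
have h1 : k j * (p * m) <= k j * S by rewrite leq_mul2l HS orbT.
have h2 : k j * (k j - p.+1 * m) <= x * (k j - p.+1 * m).
  by rewrite leq_mul2r jx orbT.
move: h2; rewrite !mulnBr; nia.
Qed.
End Growth.

(** * The bound on the number of vertices *)

Lemma low_disjoint (T : finType) (e f : rel T) :
  (forall x y, x != y -> e x y || f x y) -> [disjoint low e & low f].
Proof.
move=> ef; apply/pred0P => x /=; apply/negbTE/negP; rewrite !inE => /andP[xe xf].
have : #|[set: T] :\ x| <= deg e setT x + deg f setT x.
  rewrite -cardsUI; apply: leq_trans (leq_addr _ _).
  apply: subset_leq_card; apply/subsetP => y; rewrite !inE => /andP[yx _].
  by rewrite yx /= ef // eq_sym.
by have := cardsD1 x [set: T]; rewrite inE cardsT; lia.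
Qed.

(** The overview's [m] is [m.+1] here. [growth] gives the weak inequality; the strict one comes from
    a contradiction when equality holds. *)
Lemma no_long_path_card (I T : finType) (h : I -> rel T) m :
    (forall i, symmetric (h i)) ->
    (forall i j x y, i != j -> x != y -> h i x y || h j x y) ->
    (forall i, ~ has_path (h i) setT (#|T| - m)) -> 0 < #|I| ->
  (2 ^ #|I| - 1) * m.+1 < #|T|.
Proof.
move=> hsym hcov noP I0; rewrite ltnNge; apply/negP => leT.
have [A hA] := fin_all_exists (fun i => low_sparse_subset (hsym i) (noP i)).
have disjA i j : i != j -> [disjoint A i & A j].
  move=> ij; have [[Ai _ _ _] [Aj _ _ _]] := (hA i, hA j).
  apply: disjointWl Ai _; apply: disjointWr Aj _; apply: low_disjoint => x y.
  exact: hcov.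
pose k i := #|A i|.
have k0 i : 0 < k i by case: (hA i).
have km i : m < k i.
  have [_ Ai0 hd _] := hA i; have /card_gt0P[x xA] := Ai0.
  by have := hd x xA; rewrite -/(k i); lia.
have hdeg i : {in A i, forall x, deg (h i) (~: A i) x <= k i - m.+1}.
  by move=> x xA; have [_ _ hd _] := hA i; have := hd x xA; rewrite -/(k i); lia.
have sumE (J : {set I}) :
    \sum_(i in J) k i * (k i - m.+1) + m.+1 * \sum_(i in J) k i = \sum_(i in J) k i ^ 2.
  rewrite big_distrr -big_split; apply: eq_bigr => i _ /=.
  by rewrite [m.+1 * _]mulnC -mulnDr subnK.
have hsqr (J : {set I}) : (\sum_(i in J) k i) ^ 2 + 2 * m.+1 * \sum_(i in J) k i
    <= 3 * \sum_(i in J) k i ^ 2.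
  have : (\sum_(i in J) k i) ^ 2 <=
      \sum_(i in J) k i ^ 2 + 2 * \sum_(i in J) k i * (k i - m.+1).
    exact: (sum_card_sqr hcov hsym disjA (b := fun i => k i - m.+1) J hdeg).
  by rewrite -mulnA; have := sumE J; lia.
have [i0 _] := card_gt0P I0.
case: (arg_maxnP k (isT : predT i0)) => j _ jmax.
have [HS _] := growth k0 hsqr setT.
have [HS' HQ] := growth k0 hsqr (setT :\ j).
have {}HQ := HQ (k j) (fun i _ => jmax i isT).
have leS : \sum_(i in setT) k i <= #|T| := sum_card_disjoint disjA setT.
have cI : #|I| = #|[set: I] :\ j|.+1.
  by have := cardsD1 j setT; rewrite inE cardsT add1n.
have := hsqr setT.
move: leS HS leT; rewrite cardsT cI !(big_setD1 j (in_setT j)) /= (expnS 2).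
have := sumE (setT :\ j).
have := km j; have p2 : 0 < 2 ^ #|setT :\ j| by rewrite expn_gt0.
case: (2 ^ _) p2 HS' HQ => // p _; rewrite subn1 /= => HS' HQ kj.
move: (p * m.+1) (mulSn p m.+1) HS' HQ => a pa HS' HQ sumj leS HS leT sq.
have aE : (2 * p.+1 - 1) * m.+1 = 2 * a + m.+1.
  by rewrite mulnBl -mulnA pa; lia.
rewrite {}aE in HS leT.
have kp : a + m.+1 <= k j.
  rewrite -(leq_pmul2l (k0 j)) -[X in X <= _]addn0.
  by apply: (peel_max HQ); rewrite addn0.
have kE : k j = a + m.+1.
  apply/eqP; rewrite eqn_leq kp andbT -(leq_add2r a).
  by apply: leq_trans (leq_add (leqnn _) HS') (leq_trans leS (leq_trans leT _)); lia.
(* Equality fixes the size of the largest set and activates the sharper degree bound of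
   [low_sparse_subset]. *)
have tight : 2 * k j = #|T| + m.+1.
  have -> : #|T| = 2 * a + m.+1.
    by apply/eqP; rewrite eqn_leq leT (leq_trans HS leS).
  by rewrite kE; lia.
have [_ _ _ /(_ tight) hdj] := hA j.
pose b i := if i == j then k j - m.+2 else k i - m.+1.
have hb i : {in A i, forall x, deg (h i) (~: A i) x <= b i}.
  rewrite /b; case: eqP => [->|_]; last exact: hdeg.
  by move=> x xA; have := hdj x xA; rewrite -/(k j); lia.
have : (\sum_(i in setT) k i) ^ 2 <=
    \sum_(i in setT) k i ^ 2 + 2 * \sum_(i in setT) k i * b i.
  exact: (sum_card_sqr hcov hsym disjA (b := b) setT hb).
rewrite !(big_setD1 j (in_setT j)) /= {1}/b eqxx.
have -> : \sum_(i in setT :\ j) k i * b i =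
    \sum_(i in setT :\ j) k i * (k i - m.+1).
  by apply: eq_bigr => i; rewrite !inE andbT => /negbTE ij; rewrite /b ij.
have km2 : m.+2 <= k j.
  by have := k0 j => /card_gt0P[x /hdj]; rewrite -/(k j); lia.
(* Lowering [b j] by one gains the surplus [d = k j] in [peel_max], which contradicts
   [k j = a + m.+1]. *)
move=> sqj; have : k j * (a + m.+1) + k j <= k j * k j.
  apply: (peel_max HQ); move: sqj sumj; rewrite mulnBr -mulnn.
  have : k j * m.+2 <= k j * k j by rewrite leq_mul2l km2 orbT.
  clear -kp.
  move: (k j) (\sum_(i in _) k i) (\sum_(i in _) k i ^ 2) => K S Q.
  move: (\sum_(i in _) _) => R.
  rewrite -!mulnn; nia.
rewrite -kE.
by have := k0 j; lia.
Qed.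

(** * From vertex sequences to copies of the path graph *)

Lemma edges_path_graph l (e : {set path_graph l}) :
  e \in edges (path_graph l) ->
  exists i j : 'I_l, i.+1 = j :> nat /\ e = [set i; j].
Proof.
move=> /imsetP[[i j] /= ij ->]; move: ij; rewrite inE /= /path_adj.
by case/orP => /eqP ij; [exists i, j | exists j, i; rewrite setUC].
Qed.

Lemma missing_colour N t (c : edge_colouring N t) (H : sgraph) (f : H -> 'I_N) :
  0 < t -> #|copy_colours c f| <= t - 1 -> exists i, i \notin copy_colours c f.
Proof.
move=> t0 ct; have : 0 < #|~: copy_colours c f|.
  by have := cardsC (copy_colours c f); rewrite card_ord; lia.
by case/card_gt0P => i; rewrite inE; exists i.
Qed.

Lemma path_copy N t (c : edge_colouring N t) (i : 'I_t) l : 0 < l ->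
    has_path (fun x y => (x != y) && (c [set x; y] != i)) setT l ->
  exists2 f : path_graph l -> 'I_N, injective f & #|copy_colours c f| <= t - 1.
Proof.
move=> l0 [p [Up sp _ lp]].
have [x0 _] : exists x0 : 'I_N, x0 \in p.
  by case: p lp {Up sp} => [|x p] /=; [lia | exists x; rewrite inE eqxx].
exists (fun k : 'I_l => nth x0 p k).
  move=> a b /eqP; rewrite nth_uniq //; first by move/eqP/val_inj.
  - exact: leq_trans (ltn_ord a) lp.
  - exact: leq_trans (ltn_ord b) lp.
have := cardsC1 i; rewrite card_ord -subn1 => <-.
apply: subset_leq_card; apply/subsetP => d /imsetP[e /edges_path_graph].
move=> [a [b [ab ->]]] ->; rewrite !inE imsetU1 imset_set1 -ab.
have lt : a.+1 < size p by rewrite ab; apply: leq_trans (ltn_ord b) lp.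
by have /(sortedP x0)/(_ a lt)/andP[] := sp.
Qed.

Lemma ramsey_upper l t N : 0 < t -> 0 < l <= N ->
  N <= (2 ^ t - 1) * (N - l).+1 -> ramsey_arrow t (t - 1) (path_graph l) N.
Proof.
move=> t0 /andP[l0 lN] hN c.
pose h (i : 'I_t) (x y : 'I_N) := (x != y) && (c [set x; y] != i).
suff [i hi] : exists i, has_path (h i) setT l by exact: path_copy hi.
apply: NNPP => no.
have := @no_long_path_card _ _ h (N - l); rewrite !card_ord subKn // => H.
suff : N < N by rewrite ltnn.
apply: leq_ltn_trans hN _; apply: H => //.
- by move=> i x y; rewrite /h eq_sym setUC.
- move=> i j x y ij xy; rewrite /h xy -negb_and; apply/negP => /andP[/eqP ci /eqP cj].
  by move: ij; rewrite -ci cj eqxx.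
- by move=> i hi; apply: no; exists i.
Qed.

(** * The extremal colouring and the lower bound *)

(* The classes of the extremal colouring are the intervals
   [[level q i, level q i.+1[], the last one being unbounded; an edge has the
   index of the lowest class that it meets. *)
Definition level q i := (2 ^ i - 1) * q.

Lemma leq_level q i j : i <= j -> level q i <= level q j.
Proof. by move=> ij; rewrite leq_mul2r leq_sub2r ?orbT // leq_exp2l. Qed.

Lemma levelS q i : level q i.+1 = 2 * level q i + q.
Proof.
rewrite /level expnS; have : 0 < 2 ^ i by rewrite expn_gt0.
by case: (2 ^ i) => // n _; rewrite !mulnBl mul1n -mulnA; nia.
Qed.

(** [find] returns [t] when no bounded class is met, which is the index of the unbounded class. *)
Definition level_colour N q t (e : {set 'I_N}) :=
  find (fun i => [exists x in e, x < level q i.+1]) (iota 0 t).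

Lemma level_colour_lt N q t (e : {set 'I_N}) : level_colour q t e < t.+1.
Proof. by rewrite ltnS -[leqRHS](size_iota 0) find_size. Qed.

Lemma level_colour_pair N q t i (x y : 'I_N) :
    i <= t -> level q i <= x -> level q i <= y -> (i < t -> x < level q i.+1) ->
  level_colour q t [set x; y] = i.
Proof.
move=> it ix iy xi; rewrite /level_colour.
set P := fun _ => _.
have nP j : j < i -> P j = false.
  move=> ji; apply/negbTE/negP => /existsP[z /andP[]].
  have := leq_level q ji.
  by rewrite !inE => lj /orP[]/eqP-> ; lia.
have -> : iota 0 t = iota 0 i ++ iota i (t - i) by rewrite -iotaD subnKC.
rewrite find_cat size_iota ifF; last first.
  apply/negP => /hasP[j]; rewrite mem_iota => /= ji.
  by rewrite nP.
case: (ltnP i t) => [lt|ge]; last first.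
  by move: ge; rewrite -subn_eq0 => /eqP->; rewrite addn0.
have -> : t - i = (t - i.+1).+1 by rewrite -subSn // subSS.
rewrite /= ifT ?addn0 //; apply/existsP; exists x.
by rewrite !inE eqxx /= xi.
Qed.

(* Each vertex of B other than w has a neighbour in C on the side of w, and
   distinct vertices of B get distinct such neighbours. *)
Lemma separated_card l (B C : {set 'I_l}) (w : 'I_l) :
    [disjoint B & C] -> w \notin C ->
    (forall i j : 'I_l, i.+1 = j :> nat ->
      (i \in B -> j \in C) /\ (j \in B -> i \in C)) ->
  #|B :\ w| <= #|C|.
Proof.
move=> BC wC hB.
have w0 : 0 < l by case: (w) => n; lia.
(* [s] moves one step towards [w]; for [i != w] the default of [insubd] does not occur. Two points
   can collide only at [w], which is not in [C]. *)
pose s (i : 'I_l) : 'I_l := insubd w (if i < w then i.+1 else i.-1).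
have sv i : i != w -> s i = (if i < w then i.+1 else i.-1) :> nat.
  move=> iw; rewrite val_insubd; case: ifP => // /negP[].
  by case: ifP => h; have := ltn_ord i; have := ltn_ord w; lia.
have sC i : i \in B :\ w -> s i \in C.
  rewrite !inE => /andP[iw iB]; have := sv i iw; case: ifP => h E.
    by have [+ _] := hB i (s i) (esym E); apply.
  have [|_ ] := hB (s i) i; last by apply.
  by move: iw; rewrite -val_eqE /=; lia.
rewrite -(card_in_imset (f := s)).
  by apply: subset_leq_card; apply/subsetP => _ /imsetP[i iB ->]; exact: sC.
move=> i j iB jB E; have [iC jC] := (sC _ iB, sC _ jB).
move: iB jB iC; rewrite !inE => /andP[iw _] /andP[jw _] iC.
have nw : s i != w by apply: contraNneq wC => <-.
have [vi vj] := (sv i iw, sv j jw).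
move: (congr1 val E) vi vj nw iw jw; rewrite -!val_eqE /= => sij.
move=> si sj nw iw jw; apply: val_inj => /=.
by move: si sj; do 2 case: ifP; lia.
Qed.

Lemma card_ord_range M a b : #|[set x : 'I_M | a <= x < b]| <= b - a.
Proof.
rewrite cardE -(size_map val) -(size_iota a (b - a)); apply: uniq_leq_size.
  by rewrite (map_inj_uniq val_inj) enum_uniq.
move=> _ /mapP[x + ->]; rewrite mem_enum inE mem_iota.
by move=> /andP[ax xb]; rewrite ax /=; lia.
Qed.

Lemma ramsey_lower l t q M : (2 ^ t.+1 - 2) * q + 2 <= l ->
  ramsey_arrow t.+1 t (path_graph l) M -> l + q <= M.
Proof.
move=> hl arr; rewrite leqNgt; apply/negP => hM.
pose c : edge_colouring M t.+1 :=
  [ffun e => Ordinal (level_colour_lt q t e)].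
have [f finj] := arr c.
rewrite -[t in _ <= t](subn1 t.+1) => /(missing_colour (ltn0Sn t))[i hi].
have cE (a b : 'I_l) : a.+1 = b :> nat -> level_colour q t [set f a; f b] != i.
  move=> ab; apply: contraNneq hi => ci; apply/imsetP; exists [set a; b].
    by apply/imsetP; exists (a, b); rewrite // inE /= /path_adj ab eqxx.
  by rewrite imsetU1 imset_set1 ffunE; apply: val_inj; rewrite /= ci.
have it : i <= t by rewrite -ltnS.
(* The positions on the path are split by class: below [i] in [C], equal to [i] in [B], above [i] in
   [E]. *)
pose C := [set p : 'I_l | f p < level q i].
pose B := [set p : 'I_l | (level q i <= f p) && ((i < t) ==> (f p < level q i.+1))].
pose E := [set p : 'I_l | (i < t) && (level q i.+1 <= f p)].
have Cl : #|C| <= level q i.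
  rewrite -(card_imset _ finj) -[leqRHS]subn0.
  apply: leq_trans (card_ord_range M _ _); apply: subset_leq_card.
  by apply/subsetP => _ /imsetP[p + ->]; rewrite !inE.
have El : #|E| <= M - level q i.+1.
  rewrite -(card_imset _ finj); apply: leq_trans (card_ord_range M _ _).
  apply: subset_leq_card; apply/subsetP => _ /imsetP[p + ->].
  by rewrite !inE ltn_ord andbT => /andP[].
have lS : l <= #|C| + #|B| + #|E|.
  have : [set: 'I_l] \subset C :|: B :|: E.
    apply/subsetP => p _; rewrite !inE.
    by case: (i < t); case: (ltnP (f p)) => //=; case: (ltnP (f p)).
  move/subset_leq_card; rewrite cardsT card_ord => /leq_trans; apply.
  apply: leq_trans (leq_card_setU _ _) _.
  by rewrite leq_add2r leq_card_setU.
have disjBC : [disjoint B & C].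
  apply/pred0P => p; rewrite !inE; apply/negP => /andP[/andP[+ _]].
  by rewrite leqNgt => /negP.
have sep (a b : 'I_l) : a.+1 = b :> nat -> (a \in B -> b \in C) /\ (b \in B -> a \in C).
  move=> ab; have nc := cE a b ab; rewrite !inE; split=> /andP[h1 /implyP h2];
    rewrite ltnNge; apply: contraNN nc => h3; apply/eqP.
    exact: level_colour_pair.
  by rewrite setUC; apply: level_colour_pair.
have lv := levelS q i; have lt := leq_level q it; have lvt := levelS q t.
have lvE : level q t.+1 = (2 ^ t.+1 - 2) * q + q.
  rewrite /level -mulSnr; congr (_ * _).
  by have : 0 < 2 ^ t; rewrite ?expn_gt0 // expnS; lia.
(* If [E] is empty, then [l <= 2 * #|C| + 1 <= 2 * level q t + 1], which is too small. Otherwise [w]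
   in [E] lies outside [B], so [#|B| <= #|C|] and [l <= 2 * level q i + (M - level q i.+1) = M -
   q]. *)
have [E0|[w wE]] := set_0Vmem E.
  rewrite E0 cards0 in lS.
  have [C0|[w]] := set_0Vmem (~: C).
    by have := cardsC C; rewrite C0 cards0 card_ord; lia.
  rewrite inE => wC; have := separated_card disjBC wC sep.
  have := cardsD1 w B; move: lS Cl.
  by move: #|B| #|B :\ w| #|C| => nB nB1 nC; case: (w \in B) => /=; lia.
have /andP[ilt wi] : (i < t) && (level q i.+1 <= f w) by move: wE; rewrite inE.
have wC : w \notin C by rewrite inE -leqNgt; lia.
have wB : w \notin B by rewrite inE ilt /= negb_and -!ltnNge ltnS wi orbT.
have := separated_card disjBC wC sep.
have := cardsD1 w B; have := ltn_ord (f w); rewrite (negbTE wB).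
move: lS Cl El; move: #|B| #|B :\ w| #|C| #|E| => nB nB1 nC nE; lia.
Qed.

Theorem theorem1 (l t : nat) (hl : 2 <= l) (ht : 2 <= t) :
  chromatic_ramsey_number t (t - 1) (path_graph l)
    (l + (l - 2) %/ (2 ^ t - 2)).
Proof.
have p4 : 3 < 2 ^ t by rewrite -[4]/(2 ^ 2) leq_exp2l.
set d := 2 ^ t - 2; set q := _ %/ d.
have d0 : 0 < d by rewrite /d; lia.
have lE := divn_eq (l - 2) d; have rd := ltn_pmod (l - 2) d0.
rewrite -/q in lE; split.
  (* The remaining bound [l + q <= d.+1 * q.+1] amounts to [l - 2 < q * d + d], the remainder bound
     of the division. *)
  apply: ramsey_upper; [lia| lia|].
  rewrite addKn.
  have -> : 2 ^ t - 1 = d.+1 by rewrite /d; lia.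
  by rewrite mulSn mulnS [d * q]mulnC; lia.
move=> M; case: t ht @d @q p4 d0 lE rd => // t _ d q _ _ lE _.
rewrite subn1 => arr; apply: (ramsey_lower _ arr).
by rewrite -/d mulnC; lia.
Qed.
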